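(* Let $d\ge1$ and let $\mu$ be a non-trivial probability nc measure on $\mathscr{A}_d$ with nc Christoffel approximates $(\Lambda_n(\cdot;\mu))_{n\in\mathbb{N}}$. For every $n\in\mathbb{N}$, $k\ge1$ and $A\in(\mathbb{C}^{k\times k})^d$, $$\Lambda_n(A;\mu)=\min\big\{(\mu\otimes\mathrm{Id}_k)(Q^*Q)\;:\;Q\in(\mathbb{C}\langle Z\rangle_{\sigma(n)})^{k\times k},\;Q(A)=I_k\big\},$$ where the minimum is with respect to the Loewner order on Hermitian $k\times k$ matrices.
   Context: $\mathbb{F}_d^+$ is the free monoid on the generators $1,\dots,d$, with identity $\emptyset$ and product given by concatenation; $|\sigma|$ is the length of $\sigma$. Shortlex ordering: $\sigma\prec\tau$ if $|\sigma|<|\tau|$, or if $|\sigma|=|\tau|$ and $\sigma$ precedes $\tau$ lexicographically (with $1\prec\cdots\prec d$). $\sigma(n)=d\cdots d$ ($n$ copies) is the last word of length $n$; $\sigma(0)=\emptyset$. For a $d$-tuple $Z$ and $\sigma=\sigma_1\cdots\sigma_n$, $Z^\sigma:=Z_{\sigma_1}\cdots Z_{\sigma_n}$, $Z^\emptyset:=1$ (the identity). $\mathbb{C}\langle Z\rangle$ is the algebra of polynomials in $d$ noncommuting variables $Z_1,\dots,Z_d$ with complex coefficients (nc polynomials), and $\mathbb{C}\langle Z\rangle_{\sigma}=\mathrm{span}\{Z^\tau:\tau\preceq\sigma\}$. The nc Hardy space $\mathbb{H}^2_d$ is the Hilbert space of formal power series $\sum_{\sigma}c_\sigma Z^\sigma$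 with $\sum_\sigma|c_\sigma|^2<\infty$ and orthonormal basis $\{Z^\sigma\}$; $L=(L_1,\dots,L_d)$ is given by $(L_jf)(Z)=Z_jf(Z)$, so $L_j^*L_k=\delta_{jk}I$. $\mathcal{A}_d$ is the operator-norm closure of $\{p(L):p\in\mathbb{C}\langle Z\rangle\}$ and $\mathscr{A}_d:=\overline{\mathcal{A}_d+\mathcal{A}_d^*}$ (operator-norm closure). An nc measure is a linear functional $\mu:\mathscr{A}_d\to\mathbb{C}$ with $\mu(f)\ge0$ for all positive operators $f\in\mathscr{A}_d$. For nc polynomials $P,Q$, $\mu(Q^*P)$ means $\mu(Q(L)^*P(L))$. $\mu$ is a probability nc measure if $\mu(I)=1$; it is non-trivial if for $K_\mu(\sigma,\tau):=\mu((L^\tau)^*L^\sigma)$ the matrix $[K_\mu(\sigma,\tau)]_{\sigma,\tau\preceq\sigma_0}$ is invertible for every $\sigma_0\in\mathbb{F}_d^+$. In that case $\langle P,Q\rangle_\mu:=\mu(Q^*P)$ is an inner product on $\mathbb{C}\langle Z\rangle$, and the orthonormal polynomials $(\varphi_\sigma)_{\sigma\in\mathbb{F}_d^+}$ of $\mu$ are obtained by applying Gram–Schmidt (with normalisation, positive leading coefficients) to $\{Z^\sigma\}$ in the shortlex order with respect to $\langle\cdot,\cdot\rangle_\mu$. For $A\in(\mathbb{C}^{k\times k})^d$ the $n$-th nc Christoffel approximate is $$\Lambda_n(A;\mu):=\Big(\sum_{\emptyset\preceq\sigma\preceq\sigma(n)}\varphi_\sigma(A)\varphi_\sigma(A)^*\Big)^{-1}\in\mathbb{C}^{k\times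 k}.$$ Matrices of nc polynomials: $(\mathbb{C}\langle Z\rangle)^{k\times k}\cong\mathbb{C}\langle Z\rangle\otimes\mathbb{C}^{k\times k}$ with product $(p\otimes a)(q\otimes b)=pq\otimes ab$. For $Q=\sum_\tau Z^\tau\otimes c_\tau$ (finite sum, $c_\tau\in\mathbb{C}^{k\times k}$), the evaluation at $A\in(\mathbb{C}^{k\times k})^d$ is $Q(A):=\sum_\tau A^\tau c_\tau\in\mathbb{C}^{k\times k}$, and $(\mu\otimes\mathrm{Id}_k)(Q^*Q):=\sum_{\sigma,\tau}\mu\big((L^\sigma)^*L^\tau\big)\,c_\sigma^*c_\tau\in\mathbb{C}^{k\times k}$. The minimum of a set of Hermitian matrices in the Loewner order is an element of the set that is $\preceq$ every element of the set. *)

(* Defs.v *)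
From HB Require Import structures.
From mathcomp Require Import all_boot all_order all_algebra complex.
From mathcomp Require Import lra.
From mathcomp Require Import finmap multinomials.monalg.
From mathcomp Require Import boolp classical_sets functions reals ereal.
From mathcomp Require Import constructive_ereal numfun esum.

Set Implicit Arguments.
Unset Strict Implicit.
Unset Printing Implicit Defensive.

Import Order.TTheory GRing.Theory Num.Theory.
Import ComplexField.

Local Open Scope classical_set_scope.
Local Open Scope ring_scope.
Local Open Scope complex_scope.
Local Open Scope sesquilinear_scope.

Notation word d := {fmonom 'I_d}.

Section Words.
Variable d : nat.
Implicit Types s t : word d.

(* The reflexive order: [s] is before or equal to [t]. *)
Definition shortlex s t : bool :=
  (size s < size t)%N || (size s == size t) && (s <= t :> seqlexi 'I_d)%O.

Definition words_of_length (m : nat) : seq (word d) :=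
  [seq FMonom (val u) | u : m.-tuple 'I_d].

(* The set of the [t] with [t] before or equal to [s], in increasing order. *)
Definition initseg s : seq (word d) :=
  sort shortlex
    [seq t <- flatten [seq words_of_length m | m <- iota 0 (size s).+1]
       | shortlex t s].

Lemma mem_initseg s t : (t \in initseg s) = shortlex t s.
Proof.
rewrite /initseg mem_sort mem_filter andb_idr // => /orP t_le_s.
apply/flattenP; exists (words_of_length (size t)); last first.
  by apply/mapP; exists (in_tuple t); rewrite ?mem_enum //= fmK.
apply: map_f; rewrite mem_iota /= add0n ltnS.
by case: t_le_s => [/ltnW //|/andP[/eqP->]].
Qed.

Definition last_letter (hd : (0 < d)%N) : 'I_d :=
  Ordinal (etrans (ltn_predL d) hd).

Definition last_word (hd : (0 < d)%N) (n : nat) : word d :=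
  FMonom (nseq n (last_letter hd)).

End Words.

Section Sums.
Variables (R : realType) (T : choiceType).

(* The unconditional sum of [u], meaningful when [u] is summable. *)
Definition rsum (u : T -> R) : R :=
  fine (\esum_(t in [set: T]) (EFin \o u)^\+ t)%E
  - fine (\esum_(t in [set: T]) (EFin \o u)^\- t)%E.

Definition csum (u : T -> R[i]) : R[i] :=
  rsum (fun t => complex.Re (u t)) +i* rsum (fun t => complex.Im (u t)).

Definition square_summable (c : T -> R[i]) : Prop :=
  summable [set: T] (fun t => (Normc.normc (c t) ^+ 2)%:E).

Definition l2_pred : {pred T -> R[i]} := fun c => `[< square_summable c >].

End Sums.

Section SquareSummable.
Variables (R : realType) (T : choiceType).

Lemma normc_sqrE (z : R[i]) :
  Normc.normc z ^+ 2 = complex.Re z ^+ 2 + complex.Im z ^+ 2.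
Proof. by case: z => a b /=; rewrite sqr_sqrtr // addr_ge0 // sqr_ge0. Qed.

Lemma square_summable_bound (c : T -> R[i]) (a : T -> \bar R) (M : R) :
  0 <= M -> (forall t, 0 <= a t)%E ->
  (forall t, (Normc.normc (c t) ^+ 2)%:E <= M%:E * a t)%E ->
  summable [set: T] a -> square_summable c.
Proof.
move=> M0 a0 ca; rewrite /square_summable /summable => asum.
have {}asum : (\esum_(t in [set: T]) a t < +oo)%E.
  by apply: le_lt_trans asum; apply: le_esum => t _; exact: lee_abs.
apply: (@le_lt_trans _ _ (M%:E * \esum_(t in [set: T]) a t)%E); last first.
  by rewrite lte_mul_pinfty// ?lee_fin// fin_numElt asum (lt_le_trans _ (esum_ge0 _)).
apply: ge_ereal_sup => _ [A fA <-].
apply: (@le_trans _ _ (\sum_(t \in A) M%:E * a t)%E).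
  apply: lee_fsum => [|t _]; first by case: fA.
  by rewrite gee0_abs ?lee_fin ?sqr_ge0.
rewrite -ge0_mule_fsumr; last by [].
by rewrite lee_wpmul2l ?lee_fin//; apply: ereal_sup_ubound; exists A.
Qed.

Lemma l2_submod_closed : submod_closed (@l2_pred R T).
Proof.
have nE (z : R[i]) : (0 <= (Normc.normc z ^+ 2)%:E)%E by rewrite lee_fin sqr_ge0.
split.
  apply/asboolP; rewrite /square_summable /summable esum1 ?ltry// => t _.
  by rewrite Normc.normc0 expr0n abse0.
move=> a f g /asboolP fl2 /asboolP gl2; apply/asboolP.
pose M := 2 * Num.max 1 (Normc.normc a ^+ 2).
have M0 : 0 <= M by rewrite mulr_ge0// le_max ler01.
apply: (@square_summable_bound _
  (fun t => (Normc.normc (f t) ^+ 2)%:E + (Normc.normc (g t) ^+ 2)%:E)%E M).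
- exact: M0.
- by move=> t; rewrite adde_ge0.
- move=> t; rewrite -EFinD -EFinM lee_fin.
  have -> : (a *: f + g) t = a * f t + g t by [].
  have /le_trans -> // : Normc.normc (a * f t + g t) ^+ 2
    <= 2 * (Normc.normc (a * f t) ^+ 2 + Normc.normc (g t) ^+ 2).
    rewrite !normc_sqrE; case: (a * f t) (g t) => x y [z w] /=.
    have := sqr_ge0 (x - z); have := sqr_ge0 (y - w); nra.
  rewrite Normc.normcM exprMn /M -(mulrA 2) ler_pM2l// mulrDr lerD//.
    by rewrite ler_wpM2r ?sqr_ge0// le_max lexx orbT.
  by rewrite ler_peMl ?sqr_ge0// le_max lexx.
- exact: (summableD fl2 gl2).
Qed.

HB.instance Definition _ :=
  GRing.isSubmodClosed.Build R[i] (T -> R[i]) (@l2_pred R T) l2_submod_closed.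

End SquareSummable.

Section Hardy.
Variables (R : realType) (d : nat).

(* [f s] is the coefficient of Z^s in the power series [f]. *)
Record hardy := Hardy {
  hardy_coef :> word d -> R[i];
  hardyP : hardy_coef \in @l2_pred R (word d) }.

HB.instance Definition _ := [isSub for hardy_coef].
HB.instance Definition _ := [Choice of hardy by <:].
HB.instance Definition _ := [SubChoice_isSubLmodule of hardy by <:].


(* [hinner] is linear in its first argument. *)
Definition hinner (f g : hardy) : R[i] := csum (fun s => f s * (g s)^*).

Definition hnorm (f : hardy) : R := Num.sqrt (complex.Re (hinner f f)).

Definition operator := hardy -> hardy.

Definition bounded_operator (T : operator) : Prop :=
  linear T /\ exists M : R, forall f, hnorm (T f) <= M * hnorm f.

Definition opnorm (T : operator) : \bar R :=
  ereal_sup [set (hnorm (T f))%:E | f in [set f | hnorm f <= 1]].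

Definition norm_closure (S : set operator) : set operator :=
  [set T | bounded_operator T /\
    forall e : R, 0 < e -> exists2 T', S T' & (opnorm (T \- T')%R < e%:E)%E].

Definition is_adjoint (T T' : operator) : Prop :=
  forall f g, hinner (T f) g = hinner f (T' g).

(* The Hilbert-space adjoint; it exists and is unique when [T] is bounded, and
   is a dummy value when [T] has no adjoint. *)
Definition adjoint (T : operator) : operator :=
  xget (fun=> 0) [set T' | is_adjoint T T'].

Definition positive_operator (T : operator) : Prop :=
  bounded_operator T /\ forall f, 0 <= hinner (T f) f.

(* Left multiplication by Z_j: Z_j Z^t is Z^(jt). *)
Definition shift_coef (j : 'I_d) (f : word d -> R[i]) : word d -> R[i] :=
  fun s => if s : seq 'I_d is i :: t then
             if i == j then f (FMonom t) else 0
           else 0.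

Lemma shift_l2 j (f : hardy) : shift_coef j f \in @l2_pred R (word d).
Proof.
have /asboolP fl2 := hardyP f; apply/asboolP.
pose e (t : word d) : word d := FMonom (j :: t).
have einj : set_inj [set: word d] e.
  by move=> [s] [t] _ _ [->].
have := fl2; rewrite /square_summable /summable; congr (_ < _)%E.
transitivity (\esum_(s in e @` [set: word d])
    `|(Normc.normc (shift_coef j f s) ^+ 2)%:E|)%E.
  rewrite esum_image //; apply: eq_esum => t _.
  by rewrite /shift_coef /= eqxx fmK.
rewrite (esum_mkcond (range e)); apply: eq_esum => s _; case: s => [[|i t]].
  case: ifP => // _.
  by rewrite -[shift_coef _ _ _]/(0) Normc.normc0 expr0n abse0.
case: ifPn => // /negP it.
have -> : shift_coef j f (FMonom (i :: t)) = if i == j then f (FMonom t) else 0.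
  by [].
case: eqP it => [-> []|_ _]; last by rewrite Normc.normc0 expr0n abse0.
by apply/mem_set; exists (FMonom t).
Qed.

Definition shift (j : 'I_d) : operator := fun f => Hardy (shift_l2 j f).

(* L^s is the product L_{s_1} ... L_{s_n}. *)
Definition shift_word (s : word d) : operator :=
  fun f => foldr shift f s.

Definition ncpoly := {malg R[i][word d]}.

Definition Zpow (s : word d) : ncpoly := << s >>.

(* The subspace spanned by the Z^t with [t] before or equal to [s]. *)
Definition ncpoly_upto (s : word d) : set ncpoly :=
  [set P | exists c : word d -> R[i], P = \sum_(t <- initseg s) c t *: Zpow t].

Definition eval_shift (P : ncpoly) : operator :=
  fun f => \sum_(s <- msupp P) P@_s *: shift_word s f.

Definition disc_algebra : set operator :=
  norm_closure (range eval_shift).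

Definition operator_system : set operator :=
  norm_closure [set (S \+ adjoint T)%R | S in disc_algebra & T in disc_algebra].

(* A linear functional on the operator system is represented by a function on
   all operators, whose values outside the operator system are irrelevant. *)
Record nc_measure := NcMeasure {
  nc_fun :> operator -> R[i];
  nc_linear : forall (a : R[i]) (S T : operator),
    operator_system S -> operator_system T ->
    nc_fun (a \*: S \+ T)%R = a * nc_fun S + nc_fun T;
  nc_ge0 : forall T : operator,
    operator_system T -> positive_operator T -> 0 <= nc_fun T }.

Section Measure.
Variable mu : nc_measure.

Definition probability_nc : Prop := mu idfun = 1.

Definition moment (s t : word d) : R[i] :=
  mu (adjoint (shift_word t) \o shift_word s).

Definition moment_mx (s0 : word d) : 'M[R[i]]_(size (initseg s0)) :=
  \matrix_(i, j) moment (tnth (in_tuple (initseg s0)) i)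
                        (tnth (in_tuple (initseg s0)) j).

Definition nontrivial_nc : Prop := forall s0, moment_mx s0 \in unitmx.

Definition ncpoly_inner (P Q : ncpoly) : R[i] :=
  mu (adjoint (eval_shift Q) \o eval_shift P).

(* One step of normalised Gram-Schmidt: [prev] lists the orthonormal
   polynomials already obtained, and Z^s is the next monomial. *)
Definition gram_schmidt_step (prev : seq ncpoly) (s : word d) : seq ncpoly :=
  let psi := Zpow s - \sum_(phi <- prev) ncpoly_inner (Zpow s) phi *: phi in
  rcons prev ((sqrtC (ncpoly_inner psi psi))^-1 *: psi).

Definition orthopoly (s : word d) : ncpoly :=
  last 0 (foldl gram_schmidt_step [::] (initseg s)).

End Measure.

Section Evaluation.
Variable k : nat.
Implicit Types (A : 'I_d -> 'M[R[i]]_k) (Q : 'M[ncpoly]_k).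

Definition mx_word A (s : word d) : 'M[R[i]]_k :=
  \big[mulmx/1%:M]_(j <- s) A j.

Definition eval_mx A (P : ncpoly) : 'M[R[i]]_k :=
  \sum_(s <- msupp P) P@_s *: mx_word A s.

Definition christoffel (hd : (0 < d)%N) (mu : nc_measure) (n : nat) A
    : 'M[R[i]]_k :=
  invmx (\sum_(s <- initseg (last_word hd n))
           eval_mx A (orthopoly mu s) *m (eval_mx A (orthopoly mu s)) ^t*).

(* A matrix of polynomials [Q] is the sum of the Z^s (x) [mxcoeff Q s] for [s]
   in the finite set [mxsupp Q]. *)
Definition mxcoeff Q (s : word d) : 'M[R[i]]_k := \matrix_(i, j) (Q i j)@_s.

Definition mxsupp Q : {fset word d} :=
  \big[fsetU/fset0]_(i < k) \big[fsetU/fset0]_(j < k) msupp (Q i j).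

Definition mx_eval A Q : 'M[R[i]]_k :=
  \sum_(s <- mxsupp Q) mx_word A s *m mxcoeff Q s.

(* The image of Q^*Q under mu (x) Id_k. *)
Definition mx_gram (mu : nc_measure) Q : 'M[R[i]]_k :=
  \sum_(s <- mxsupp Q) \sum_(t <- mxsupp Q)
    mu (adjoint (shift_word s) \o shift_word t)
      *: ((mxcoeff Q s) ^t* *m mxcoeff Q t).

End Evaluation.
End Hardy.

Section Loewner.
Variables (R : realType) (k : nat).
Implicit Types (M N : 'M[R[i]]_k) (S : set 'M[R[i]]_k).

Definition psdmx M : Prop :=
  M \is hermsymmx /\ forall v : 'cV[R[i]]_k, 0 <= (v ^t* *m M *m v) 0 0.

Definition loewner_le M N : Prop := psdmx (N - M).

Definition loewner_min S M : Prop :=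
  [/\ forall N, S N -> N \is hermsymmx, S M & forall N, S N -> loewner_le M N].

End Loewner.

(* Main.v *)
(** Write [phi_1, ..., phi_N] for the orthonormal polynomials up to [d...d]
([n] letters), which Gram-Schmidt produces from the positive definite form
[<P, Q> = mu(Q^* P)].  A matrix polynomial [Q] in their span is
[\sum_l phi_l (x) X_l] with arbitrary matrix Fourier coefficients [X_l]; then
[(mu (x) Id)(Q^* Q) = \sum_l X_l^* X_l] and [Q(A) = \sum_l phi_l(A) X_l].  So the
statement is a matrix least-squares problem: with [S = \sum_l phi_l(A) phi_l(A)^*],
the minimiser of [\sum_l X_l^* X_l] under [\sum_l phi_l(A) X_l = 1] is
[X_l = phi_l(A)^* S^-1], with value [S^-1].  Here [S] is invertible because the
constant polynomial [1] is feasible. *)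

(* Most of the work lies in making [mu(Q^* P)] a genuine inner product. An [nc_measure] is linear
   only on [operator_system], and [adjoint] is a choice, so before any expansion in moments the
   operators [(L^t)^* L^s] must be computed explicitly and placed in that system; this is why the
   Hardy inner product is built up from unconditional sums. Hermitian symmetry is not part of
   [nc_measure]: it comes from positivity by polarization. Definiteness is then recovered from the
   invertible moment matrices, because a null vector of a positive semidefinite form is orthogonal
   to everything. A further obstacle is that each [orthopoly s] is defined by its own run of
   Gram-Schmidt, while the argument needs one orthonormal family for the whole segment. *)
Require Import Defs.
From mathcomp Require Import all_boot all_order all_algebra complex.
From mathcomp Require Import ring lra.
From mathcomp Require Import finmap multinomials.monalg.
From mathcomp Require Import boolp classical_sets functions cardinality fsbigop
  reals ereal.
From mathcomp Require Import constructive_ereal numfun esum.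

Set Implicit Arguments.
Unset Strict Implicit.
Unset Printing Implicit Defensive.

Import Order.TTheory GRing.Theory Num.Theory.
Import ComplexField.

Local Open Scope classical_set_scope.
Local Open Scope ring_scope.
Local Open Scope sesquilinear_scope.

(** * Linearity and positivity of real unconditional sums *)

Section UnconditionalSums.
Context {R : realType} {T : choiceType}.
Implicit Types (u v p q : T -> R) (c : R).

Definition rsummable u : Prop := summable [set: T] (EFin \o u).

Lemma le_rsummable u v : (forall t, `|u t| <= v t) -> rsummable v -> rsummable u.
Proof.
move=> uv; apply: le_lt_trans; apply: le_esum => t _ /=.
by rewrite lee_fin (le_trans (uv t)) // ler_norm.
Qed.

Lemma rsummableD u v : rsummable u -> rsummable v -> rsummable (fun t => u t + v t).
Proof. exact: summableD. Qed.

Lemma esum_fin p : (forall t, 0 <= p t) -> rsummable p ->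
  (\esum_(t in [set: T]) (p t)%:E)%E \is a fin_num.
Proof.
move=> p0; rewrite /rsummable summableE; congr (_ \is a fin_num).
by apply: eq_esum => t _; rewrite gee0_abs // lee_fin.
Qed.

Lemma le_esumZ c p : 0 <= c -> (forall t, 0 <= p t) ->
  (\esum_(t in [set: T]) (c * p t)%:E <= c%:E * \esum_(t in [set: T]) (p t)%:E)%E.
Proof.
move=> c0 p0; apply: ge_ereal_sup => _ [A fA <-].
rewrite [leLHS](_ : _ = \sum_(t \in A) c%:E * (p t)%:E)%E; last first.
  by apply: eq_fsbigr => t _; rewrite EFinM.
rewrite -ge0_mule_fsumr; last by move=> t; rewrite lee_fin.
by rewrite lee_wpmul2l ?lee_fin//; apply: ereal_sup_ubound; exists A.
Qed.

(** The missing inequality is [le_esumZ] again, for the factor [c^-1] and the function [c * p]. *)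
Lemma esumZ c p : 0 <= c -> (forall t, 0 <= p t) ->
  (\esum_(t in [set: T]) (c * p t)%:E = c%:E * \esum_(t in [set: T]) (p t)%:E)%E.
Proof.
move=> c0 p0; have [->|c_neq0] := eqVneq c 0.
  by rewrite mul0e esum1 // => t _; rewrite mul0r.
have c_gt0 : 0 < c by rewrite lt_def c_neq0.
apply/eqP; rewrite eq_le le_esumZ //= -lee_pdivlMl //.
apply: le_trans (le_esumZ _ _); rewrite ?invr_ge0 //; last first.
  by move=> t; rewrite mulr_ge0.
by apply: le_esum => t _; rewrite mulrA mulVf // mul1r.
Qed.

Lemma rsummableZ c u : rsummable u -> rsummable (fun t => c * u t).
Proof.
move=> su; have su' : rsummable (fun t => `|u t|).
  move: su; rewrite /rsummable /summable; congr (_ < _)%E.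
  by apply: eq_esum => t _ /=; rewrite normr_id.
apply: (@le_rsummable _ (fun t => `|c| * `|u t|)) => [t|].
  by rewrite normrM.
rewrite /rsummable /summable.
rewrite (eq_esum (b := fun t => (`|c| * `|u t|)%:E)) => [|t _ /=]; last first.
  by rewrite normrM !normr_id.
rewrite esumZ // ltey_eq fin_numM // esum_fin //.
Qed.

(** Positive and negative parts are not additive, so the definition of [rsum] does not show
    linearity. Since any splitting into nonnegative summable functions gives the same value,
    splittings can be added and scaled instead. *)
Lemma rsumB p q : (forall t, 0 <= p t) -> (forall t, 0 <= q t) ->
  rsummable p -> rsummable q ->
  rsum (fun t => p t - q t) =
  fine (\esum_(t in [set: T]) (p t)%:E)%E - fine (\esum_(t in [set: T]) (q t)%:E)%E.
Proof.
move=> p0 q0 sp sq.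
have finpn w : rsummable w ->
    ((\esum_(t in [set: T]) (EFin \o w)^\+ t)%E \is a fin_num) /\
    ((\esum_(t in [set: T]) (EFin \o w)^\- t)%E \is a fin_num).
  move=> sw; split.
    have := summable_funepos sw; rewrite summableE; congr (_ \is a fin_num).
    by apply: eq_esum => t _; rewrite gee0_abs.
  have := summable_funeneg sw; rewrite summableE; congr (_ \is a fin_num).
  by apply: eq_esum => t _; rewrite gee0_abs.
have spq : rsummable (fun t => p t - q t) by exact: (summableB sp sq).
have [fp fn] := finpn _ spq.
rewrite /rsum -fineB // -fineB ?esum_fin //; congr fine.
have := @esumB R T [set: T] (EFin \o p) (EFin \o q) sp sq.
by apply => t _; rewrite lee_fin.
Qed.

Lemma rsum_ge0E p : (forall t, 0 <= p t) -> rsummable p ->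
  rsum p = fine (\esum_(t in [set: T]) (p t)%:E)%E.
Proof.
move=> p0 sp; have s0 : rsummable (fun=> 0).
  by apply: le_rsummable sp => t; rewrite normr0.
have -> : p = (fun t => p t - 0) by apply/funext => t; rewrite subr0.
rewrite rsumB // (esum1 (a := fun=> 0%:E)) // subr0.
by congr (fine _); apply: eq_esum => t _; rewrite subr0.
Qed.

Lemma nonneg_split u : rsummable u -> exists p q,
  [/\ forall t, 0 <= p t, forall t, 0 <= q t, rsummable p, rsummable q &
      u = fun t => p t - q t].
Proof.
move=> su; exists (fun t => Num.max (u t) 0), (fun t => Num.max (- u t) 0).
have su' : rsummable (fun t => `|u t|).
  move: su; rewrite /rsummable /summable; congr (_ < _)%E.
  by apply: eq_esum => t _ /=; rewrite normr_id.
split.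
- by move=> t; rewrite le_max lexx orbT.
- by move=> t; rewrite le_max lexx orbT.
- apply: le_rsummable su' => t; rewrite ger0_norm ?le_max ?lexx ?orbT //.
  by rewrite ge_max normr_ge0 ler_norm.
- apply: le_rsummable su' => t; rewrite ger0_norm ?le_max ?lexx ?orbT //.
  by rewrite ge_max normr_ge0 -normrN ler_norm.
- apply/funext => t; have [u0|/ltW u0] := leP 0 (u t).
    by rewrite max_r ?subr0 // oppr_le0.
  by rewrite max_l ?opprK ?add0r // oppr_ge0.
Qed.

Lemma rsumD u v : rsummable u -> rsummable v ->
  rsum (fun t => u t + v t) = rsum u + rsum v.
Proof.
move=> /nonneg_split[p [q [p0 q0 sp sq ->]]].
move=> /nonneg_split[p' [q' [p'0 q'0 sp' sq' ->]]].
have -> : (fun t => p t - q t + (p' t - q' t)) = (fun t => (p t + p' t) - (q t + q' t)).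
  by apply/funext => t; rewrite opprD addrACA.
have sum2 w w' : (forall t, 0 <= w t) -> (forall t, 0 <= w' t) -> rsummable w ->
    rsummable w' -> fine (\esum_(t in [set: T]) (w t + w' t)%:E)%E =
    fine (\esum_(t in [set: T]) (w t)%:E)%E + fine (\esum_(t in [set: T]) (w' t)%:E)%E.
  move=> w0 w'0 sw sw'; rewrite -fineD ?esum_fin // -esumD //.
    by move=> t _; rewrite lee_fin.
  by move=> t _; rewrite lee_fin.
rewrite !rsumB //; try (by move=> t; rewrite addr_ge0); try exact: rsummableD.
by rewrite (sum2 p) // (sum2 q) // opprD addrACA.
Qed.

Lemma rsumN u : rsummable u -> rsum (fun t => - u t) = - rsum u.
Proof.
move=> /nonneg_split[p [q [p0 q0 sp sq ->]]].
have -> : (fun t => - (p t - q t)) = (fun t => q t - p t).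
  by apply/funext => t; rewrite opprB.
by rewrite !rsumB // opprB.
Qed.

Lemma rsumZ c u : rsummable u -> rsum (fun t => c * u t) = c * rsum u.
Proof.
wlog c0 : c / 0 <= c => [hw su|].
  have [|/ltW c0] := leP 0 c; first by move/hw => ->.
  rewrite -[c in LHS]opprK -[c in RHS]opprK mulNr -hw ?oppr_ge0 //.
  rewrite -rsumN; last exact: rsummableZ.
  by congr rsum; apply/funext => t; rewrite mulNr.
move=> /nonneg_split[p [q [p0 q0 sp sq ->]]].
have -> : (fun t => c * (p t - q t)) = (fun t => c * p t - c * q t).
  by apply/funext => t; rewrite mulrBr.
rewrite !rsumB //; try (by move=> t; rewrite mulr_ge0); try exact: rsummableZ.
by rewrite !esumZ // !fineM ?esum_fin // mulrBr.
Qed.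

Lemma rsum_ge0 p : (forall t, 0 <= p t) -> rsummable p -> 0 <= rsum p.
Proof.
move=> p0 sp; rewrite rsum_ge0E // fine_ge0 // esum_ge0 // => t _.
by rewrite lee_fin.
Qed.

Lemma rsum_eq0 p : (forall t, 0 <= p t) -> rsummable p -> rsum p = 0 ->
  forall t, p t = 0.
Proof.
move=> p0 sp; rewrite rsum_ge0E // => p_sum0 t.
apply/eqP; rewrite eq_le p0 andbT -lee_fin -[0%R]p_sum0 fineK ?esum_fin //.
apply: esum_ge; exists [set t]; first by split => //; exact: finite_set1.
by rewrite fsbig_set1.
Qed.

End UnconditionalSums.

(** * Reindexing sums along an injection *)

Section Reindexing.
Context {R : realType} {T T' : choiceType}.
Variables (e : T -> T') (e_inj : injective e).

Let e_set_inj : set_inj [set: T] e.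
Proof. by move=> x y _ _; exact: e_inj. Qed.

Lemma esum_reindex_inj (a : T' -> \bar R) :
    (forall s, ~ range e s -> a s = 0)%E ->
  (\esum_(s in [set: T']) a s = \esum_(t in [set: T]) a (e t))%E.
Proof.
move=> a0; rewrite -(@esum_image _ _ _ _ _ a e_set_inj).
rewrite [RHS]esum_mkcond; apply: eq_esum => s _.
by case: ifPn => // /negP sNe; apply: a0 => se; apply: sNe; rewrite inE.
Qed.

Lemma rsum_reindex_inj (u : T' -> R) : (forall s, ~ range e s -> u s = 0) ->
  rsum u = rsum (u \o e).
Proof.
move=> u0; rewrite /rsum; congr (fine _ - fine _).
  rewrite esum_reindex_inj => [|s /u0 us0]; last by rewrite funeposE /= us0 maxxx.
  by apply: eq_esum => t _; rewrite !funeposE.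
rewrite esum_reindex_inj => [|s /u0 us0]; last by rewrite funenegE /= us0 oppr0 maxxx.
by apply: eq_esum => t _; rewrite !funenegE.
Qed.

Lemma rsummable_comp_inj (u : T' -> R) : rsummable u -> rsummable (u \o e).
Proof.
apply: le_lt_trans; rewrite -(@esum_image _ _ _ _ _ (fun s => `|(u s)%:E|%E) e_set_inj).
rewrite esum_mkcond; apply: le_esum => s _.
by case: ifP => // _; exact: abse_ge0.
Qed.

End Reindexing.

(** * Complex sums, real and imaginary parts separately *)

Section ComplexSums.
Context {R : realType} {T : choiceType}.
Implicit Types (u v : T -> R[i]) (c : R[i]).

Definition csummable u : Prop :=
  rsummable (fun t => complex.Re (u t)) /\ rsummable (fun t => complex.Im (u t)).

Lemma csummableZ c u : csummable u -> csummable (fun t => c * u t).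
Proof.
case: c => a b [su su']; split.
  have := rsummableD (rsummableZ a su) (rsummableZ (- b) su').
  by congr rsummable; apply/funext => t; case: (u t) => x y /=; rewrite mulNr.
have := rsummableD (rsummableZ a su') (rsummableZ b su).
by congr rsummable; apply/funext => t; case: (u t) => x y /=.
Qed.

Lemma csumZ c u : csummable u -> csum (fun t => c * u t) = c * csum u.
Proof.
case: c => a b [su su']; rewrite /csum; congr (_ +i* _)%C.
  transitivity (rsum (fun t => a * complex.Re (u t) + (- b) * complex.Im (u t))).
    by congr rsum; apply/funext => t; case: (u t) => x y /=; rewrite mulNr.
  by rewrite rsumD ?rsumZ ?mulNr //; exact: rsummableZ.
transitivity (rsum (fun t => a * complex.Im (u t) + b * complex.Re (u t))).
  by congr rsum; apply/funext => t; case: (u t) => x y /=.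
by rewrite rsumD ?rsumZ //; exact: rsummableZ.
Qed.

Lemma csumD u v : csummable u -> csummable v ->
  csum (fun t => u t + v t) = csum u + csum v.
Proof.
move=> [su su'] [sv sv']; rewrite /csum; congr (_ +i* _)%C.
  by rewrite -rsumD //; congr rsum; apply/funext => t; case: (u t) (v t) => ? ? [].
by rewrite -rsumD //; congr rsum; apply/funext => t; case: (u t) (v t) => ? ? [].
Qed.

Lemma csum_conj u : csummable u -> csum (fun t => (u t)^*) = (csum u)^*.
Proof.
move=> [su su']; rewrite /csum; congr (_ +i* _)%C.
  by congr rsum; apply/funext => t; case: (u t).
by rewrite -rsumN //; congr rsum; apply/funext => t; case: (u t).
Qed.

Lemma csum_reindex_inj (T' : choiceType) (e : T' -> T) u : injective e ->
  (forall s, ~ range e s -> u s = 0) -> csum u = csum (u \o e).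
Proof.
by move=> e_inj u0; rewrite /csum; congr (_ +i* _)%C;
  apply: (rsum_reindex_inj e_inj) => s /u0 ->.
Qed.

Lemma square_summableE u : square_summable u =
  rsummable (fun t => Normc.normc (u t) ^+ 2).
Proof. by []. Qed.

(** Both parts of [u t * (v t)^*] are dominated by [|u t|^2 + |v t|^2]; the squares passed to [nra]
    are the AM-GM inequalities for the four cross products. *)
Lemma csummable_l2 u v : square_summable u -> square_summable v ->
  csummable (fun t => u t * (v t)^*).
Proof.
move=> su sv; have suv := rsummableD su sv.
split; apply: le_rsummable suv => t; rewrite !normc_sqrE;
  case: (u t) (v t) => a b [x y] /=; rewrite ler_norml; apply/andP; split;
  have := sqr_ge0 (a - x); have := sqr_ge0 (a + x); have := sqr_ge0 (b - y);
  have := sqr_ge0 (b + y); have := sqr_ge0 (a - y); have := sqr_ge0 (a + y);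
  have := sqr_ge0 (b - x); have := sqr_ge0 (b + x); nra.
Qed.

End ComplexSums.

(** * The inner product of the Hardy space and uniqueness of adjoints *)

Section HardyInner.
Context {R : realType} {d : nat}.
Implicit Types f g h : hardy R d.

Lemma hardy_eqP f g : (forall s, f s = g s) <-> f = g.
Proof. by split=> [fg|-> //]; apply: val_inj; apply/funext => s; exact: fg. Qed.

Lemma csummable_hinner f g : csummable (fun s => f s * (g s)^*).
Proof. by apply: csummable_l2; apply/asboolP; exact: hardyP. Qed.

Lemma hinner_linear g : linear_for *%R (fun f => hinner f g).
Proof.
move=> a f h; rewrite /hinner -csumZ; last exact: csummable_hinner.
rewrite -csumD; [|apply: csummableZ; exact: csummable_hinner|exact: csummable_hinner].
by congr csum; apply/funext => s; rewrite mulrA -mulrDl.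
Qed.

Lemma hinnerC f g : hinner g f = (hinner f g)^*.
Proof.
rewrite -csum_conj; last exact: csummable_hinner.
by congr csum; apply/funext => s; rewrite rmorphM /= conjCK mulrC.
Qed.

Lemma hinner_linearr f a g h : hinner f (a *: g + h) = a^* * hinner f g + hinner f h.
Proof. by rewrite hinnerC hinner_linear rmorphD rmorphM /= -!hinnerC. Qed.

Lemma hinner0 f : hinner f 0 = 0.
Proof.
have := hinner_linearr f 1 0 0; rewrite scaler0 addr0 rmorph1 mul1r.
by move=> /eqP; rewrite -subr_eq0 opprD addNKr oppr_eq0 => /eqP.
Qed.

Lemma hinner_normE f : hinner f f =
  (rsum (fun s => Normc.normc (f s) ^+ 2))%:C%C.
Proof.
rewrite /hinner /csum; congr (_ +i* _)%C.
  by congr rsum; apply/funext => s; rewrite normc_sqrE; case: (f s) => a b /=;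
     rewrite mulrN opprK !expr2.
rewrite -[RHS](mul0r (rsum (fun s => Normc.normc (f s) ^+ 2))) -rsumZ; last first.
  by apply/asboolP; exact: hardyP.
congr rsum; apply/funext => s; case: (f s) => a b /=.
by rewrite mul0r mulrN addrC mulrC subrr.
Qed.

Lemma hinner_ge0 f : 0 <= hinner f f.
Proof.
rewrite hinner_normE ler0c; apply: rsum_ge0 => [t|]; first exact: sqr_ge0.
by apply/asboolP; exact: hardyP.
Qed.

Lemma hinner_eq0 f : hinner f f = 0 -> f = 0.
Proof.
rewrite hinner_normE => /(congr1 (@complex.Re R)) /= f0.
apply/hardy_eqP => s; apply: Normc.eq0_normc; apply/eqP.
rewrite -sqrf_eq0; apply/eqP; move: s; apply: rsum_eq0 f0 => [s|]; first exact: sqr_ge0.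
by apply/asboolP; exact: hardyP.
Qed.

Lemma is_adjoint_uniq (S T T' : operator R d) :
  is_adjoint S T -> is_adjoint S T' -> T = T'.
Proof.
move=> ST ST'; apply/funext => f; apply/eqP; rewrite -subr_eq0; apply/eqP.
apply: hinner_eq0; set g := T f - T' f.
rewrite {2}/g addrC -scaleN1r hinner_linearr -ST -ST' rmorphN rmorph1.
by rewrite mulN1r addNr.
Qed.

(** The way to compute the chosen [adjoint]: exhibit an explicit adjoint and let uniqueness identify
    the two. *)
Lemma adjointP (S T : operator R d) : is_adjoint S T -> adjoint S = T.
Proof.
move=> ST; apply: (@is_adjoint_uniq S) => //.
exact: (@xgetPex _ _ [set T' | is_adjoint S T'] (ex_intro _ T ST)).
Qed.

End HardyInner.

(** * Sums over the support of a polynomial, linear or antilinear in it *)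

Section SumsOverSupport.
Context {C : comNzRingType} {K : choiceType} {V : lmodType C}.
Variables (phi : {rmorphism C -> C}) (h : K -> V).
Implicit Types P Q : {malg C[K]}.

Lemma msum_incl (E : {fset K}) P : (msupp P `<=` E)%fset ->
  \sum_(s <- msupp P) phi P@_s *: h s = \sum_(s <- E) phi P@_s *: h s.
Proof.
move=> PE; apply: (big_fset_incl _ PE) => s sE sP /=.
by rewrite mcoeff_outdom // rmorph0 scale0r.
Qed.

(** The three supports differ, so all sums are first extended to [msupp P] united with [msupp Q].
    Taking [phi] to be [idfun] or [Num.conj] covers evaluations at the shifts and at their adjoints
    alike. *)
Lemma msum_semilinear a P Q :
  \sum_(s <- msupp (a *: P + Q)) phi (a *: P + Q)@_s *: h s =
  phi a *: (\sum_(s <- msupp P) phi P@_s *: h s) +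
  \sum_(s <- msupp Q) phi Q@_s *: h s.
Proof.
pose E := (msupp P `|` msupp Q)%fset.
have PE : (msupp P `<=` E)%fset by exact: fsubsetUl.
have QE : (msupp Q `<=` E)%fset by exact: fsubsetUr.
have PQE : (msupp (a *: P + Q) `<=` E)%fset.
  apply: fsubset_trans (msuppD_le _ _) _; apply: fsetSU; exact: msuppZ_le.
rewrite (msum_incl PE) (msum_incl QE) (msum_incl PQE) scaler_sumr -big_split /=.
by apply: eq_bigr => s _; rewrite mcoeffD mcoeffZ rmorphD rmorphM scalerDl scalerA.
Qed.

Lemma msumU s : \sum_(t <- msupp (<< s >> : {malg C[K]})) phi (<< s >>)@_t *: h t = h s.
Proof.
by rewrite msuppU oner_eq0 big_seq_fset1 mcoeffUU rmorph1 scale1r.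
Qed.

End SumsOverSupport.

(** * Shifts, their adjoints, and the Toeplitz operators inside the operator system *)

Section Operators.
Context {R : realType} {d : nat}.
Implicit Types (f g h : hardy R d) (S T : operator R d) (P Q : ncpoly R d) (a : R[i]).

Lemma hinnerDl f g h : hinner (f + g) h = hinner f h + hinner g h.
Proof. by have := hinner_linear h 1 f g; rewrite scale1r mul1r. Qed.

Lemma hinnerDr f g h : hinner f (g + h) = hinner f g + hinner f h.
Proof. by have := hinner_linearr f 1 g h; rewrite scale1r rmorph1 mul1r. Qed.

Lemma hinner0l f : hinner 0 f = 0.
Proof. by rewrite hinnerC hinner0 rmorph0. Qed.

Lemma hinnerZl a f g : hinner (a *: f) g = a * hinner f g.
Proof. by have := hinner_linear g a f 0; rewrite hinner0l !addr0. Qed.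

Lemma hinnerZr a f g : hinner f (a *: g) = a^* * hinner f g.
Proof. by have := hinner_linearr f a g 0; rewrite hinner0 !addr0. Qed.

Lemma hinner_suml I (r : seq I) (F : I -> hardy R d) g :
  hinner (\sum_(i <- r) F i) g = \sum_(i <- r) hinner (F i) g.
Proof.
by elim/big_rec2: _ => [|i x y _ <-]; [exact: hinner0l | exact: hinnerDl].
Qed.

Lemma hinner_sumr I (r : seq I) (F : I -> hardy R d) g :
  hinner g (\sum_(i <- r) F i) = \sum_(i <- r) hinner g (F i).
Proof.
by elim/big_rec2: _ => [|i x y _ <-]; [exact: hinner0 | exact: hinnerDr].
Qed.

Definition sqnorm f : R := complex.Re (hinner f f).

Lemma sqnormE f : hinner f f = (sqnorm f)%:C%C.
Proof. by rewrite /sqnorm hinner_normE. Qed.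

Lemma sqnorm_ge0 f : 0 <= sqnorm f.
Proof. by have := hinner_ge0 f; rewrite sqnormE ler0c. Qed.

Lemma ReD (x y : R[i]) : complex.Re (x + y) = complex.Re x + complex.Re y.
Proof. by case: x y => ? ? []. Qed.

Lemma ReN (x : R[i]) : complex.Re (- x) = - complex.Re x.
Proof. by case: x. Qed.

Lemma Re_conj (x : R[i]) : complex.Re x^* = complex.Re x.
Proof. by case: x. Qed.

(** The difference of the two sides is [|f - g|^2]. Only boundedness is at stake, so this crude
    constant replaces the triangle inequality. *)
Lemma sqnormD_le f g : sqnorm (f + g) <= 2 * (sqnorm f + sqnorm g).
Proof.
have := sqnorm_ge0 (f + (-1) *: g); rewrite /sqnorm.
rewrite !(hinnerDl, hinnerDr, hinnerZl, hinnerZr) rmorphN rmorph1 !mulN1r opprK.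
by rewrite !ReD !ReN; lra.
Qed.

Lemma sqnormZ a f : sqnorm (a *: f) = Normc.normc a ^+ 2 * sqnorm f.
Proof.
rewrite [LHS]/sqnorm hinnerZl hinnerZr sqnormE normc_sqrE; case: a => x y.
by rewrite [LHS](_ : _ = complex.Re ((x +i* y) * ((x -i* y) * (sqnorm f)%:C))%C) //=; lra.
Qed.

(** Bounding squared norms keeps square roots out of the closure properties; they return only in
    [sq_boundedP]. *)
Definition sq_bounded T : Prop :=
  exists2 M : R, 0 <= M & forall f, sqnorm (T f) <= M * sqnorm f.

Lemma sq_boundedP T : linear T -> sq_bounded T -> bounded_operator T.
Proof.
move=> linT [M M0 TM]; split=> //; exists (Num.sqrt M) => f.
by rewrite /hnorm -sqrtrM //; apply: ler_wsqrtr; exact: TM.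
Qed.

Lemma sq_bounded_comb a S T : sq_bounded S -> sq_bounded T ->
  sq_bounded (fun f => a *: S f + T f).
Proof.
move=> [M M0 SM] [M' M'0 TM].
exists (2 * (Normc.normc a ^+ 2 * M + M')).
  by rewrite mulr_ge0 // addr_ge0 // mulr_ge0 // sqr_ge0.
move=> f; apply: le_trans (sqnormD_le _ _) _.
rewrite sqnormZ -(mulrA 2) ler_pM2l // mulrDl; apply: lerD => //.
by rewrite -[leRHS]mulrA; apply: ler_wpM2l => //; exact: sqr_ge0.
Qed.

Lemma sq_bounded0 : sq_bounded (fun=> 0).
Proof. by exists 0 => // f; rewrite /sqnorm hinner0 mul0r. Qed.

Lemma sq_bounded_sum I (r : seq I) (c : I -> R[i]) (F : I -> operator R d) :
  (forall i, sq_bounded (F i)) -> sq_bounded (fun f => \sum_(i <- r) c i *: F i f).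
Proof.
move=> Fb; elim: r => [|i r IH].
  by under eq_fun do rewrite big_nil; exact: sq_bounded0.
by under eq_fun do rewrite big_cons; exact: sq_bounded_comb.
Qed.

Lemma linear_sum I (r : seq I) (c : I -> R[i]) (F : I -> operator R d) :
  (forall i, linear (F i)) -> linear (fun f => \sum_(i <- r) c i *: F i f).
Proof.
move=> Flin a f g; rewrite scaler_sumr -big_split; apply: eq_bigr => i _ /=.
by rewrite Flin scalerDr !scalerA mulrC.
Qed.

Definition prefix_letter (j : 'I_d) (t : word d) : word d := FMonom (j :: t).

Lemma prefix_letter_inj j : injective (prefix_letter j).
Proof. by move=> [s] [t] [->]. Qed.

Lemma shift_prefix j k f t :
  shift j f (prefix_letter k t) = if k == j then f t else 0.
Proof. by rewrite /= /shift_coef /= fmK. Qed.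

Lemma backshift_l2 j f :
  (fun t => f (prefix_letter j t)) \in @l2_pred R (word d).
Proof.
have /asboolP fl2 := hardyP f; apply/asboolP; move: fl2.
rewrite !square_summableE => fl2.
exact: (rsummable_comp_inj (@prefix_letter_inj j) fl2).
Qed.

Definition backshift j : operator R d := fun f => Hardy (backshift_l2 j f).

Lemma shift_adjoint j : is_adjoint (shift j) (backshift j).
Proof.
move=> f g; rewrite /hinner (csum_reindex_inj (@prefix_letter_inj j)).
  by congr csum; apply/funext => t; rewrite [LHS]/comp shift_prefix eqxx.
case=> [[|i s] sj]; first exact: mul0r.
have := shift_prefix j i f (FMonom s); rewrite /prefix_letter /= => ->.
case: eqP => [ij|_]; last by rewrite mul0r.
by case: sj; exists (FMonom s) => //; rewrite /prefix_letter ij.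
Qed.

Lemma backshift_shift j k f : backshift j (shift k f) = if j == k then f else 0.
Proof.
apply/hardy_eqP => t; by rewrite [LHS]shift_prefix; case: ifP.
Qed.

Lemma shift_linear j : linear (shift j : operator R d).
Proof.
move=> a f g; apply/hardy_eqP; case=> [[|i s]].
  by rewrite [RHS](_ : _ = a * 0 + 0) // mulr0 addr0.
rewrite [LHS](_ : _ = if i == j then a * f (FMonom s) + g (FMonom s) else 0) //.
rewrite [RHS](_ : _ = a * (if i == j then f (FMonom s) else 0) +
   (if i == j then g (FMonom s) else 0)) //.
by case: ifP => // _; rewrite mulr0 addr0.
Qed.

Lemma backshift_linear j : linear (backshift j).
Proof. by move=> a f g; apply/hardy_eqP. Qed.

Lemma sqnorm_shift j f : sqnorm (shift j f) = sqnorm f.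
Proof. by rewrite /sqnorm shift_adjoint backshift_shift eqxx. Qed.

(* [0 <= |f - L_j L_j^* f|^2 = |f|^2 - |L_j^* f|^2] *)
Lemma sqnorm_backshift j f : sqnorm (backshift j f) <= sqnorm f.
Proof.
have := sqnorm_ge0 (f + (-1) *: shift j (backshift j f)); rewrite {1}/sqnorm.
rewrite !(hinnerDl, hinnerDr, hinnerZl, hinnerZr) rmorphN rmorph1 !mulN1r opprK.
rewrite (hinnerC (shift j (backshift j f)) f) !shift_adjoint backshift_shift eqxx.
rewrite !(ReD, ReN, Re_conj) /sqnorm; lra.
Qed.

(** [foldl] here against [foldr] in [shift_word]: the adjoint reverses the product, so the first
    letter of [s] is removed first. *)
Definition backshift_word (s : word d) : operator R d :=
  fun f => foldl (fun g j => backshift j g) f s.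

Lemma shift_word_adjoint s :
  is_adjoint (shift_word s : operator R d) (backshift_word s).
Proof.
move=> f g; rewrite /shift_word /backshift_word.
by elim: (s : seq 'I_d) g => //= j t IH g; rewrite shift_adjoint IH.
Qed.

Lemma shift_word_linear s : linear (shift_word s : operator R d).
Proof.
rewrite /shift_word => a f g.
by elim: (s : seq 'I_d) => //= j t ->; rewrite shift_linear.
Qed.

Lemma backshift_word_linear s : linear (backshift_word s).
Proof.
rewrite /backshift_word => a f g.
by elim: (s : seq 'I_d) f g => //= j t IH f g; rewrite backshift_linear IH.
Qed.

Lemma sq_bounded_shift_word s : sq_bounded (shift_word s : operator R d).
Proof.
exists 1 => // f; rewrite mul1r /shift_word.
by elim: (s : seq 'I_d) => //= j t; rewrite sqnorm_shift.
Qed.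

Lemma sq_bounded_backshift_word s : sq_bounded (backshift_word s).
Proof.
exists 1 => // f; rewrite mul1r /backshift_word.
elim: (s : seq 'I_d) f => //= j t IH f; apply: le_trans (IH _) _.
exact: sqnorm_backshift.
Qed.

Definition eval_backshift P : operator R d :=
  fun f => \sum_(s <- msupp P) (P@_s)^* *: backshift_word s f.

Lemma eval_shift_adjoint P : is_adjoint (eval_shift P) (eval_backshift P).
Proof.
move=> f g; rewrite /eval_shift /eval_backshift hinner_suml hinner_sumr.
by apply: eq_bigr => s _; rewrite hinnerZl hinnerZr conjCK shift_word_adjoint.
Qed.

Lemma eval_shift_comb a P Q :
  eval_shift (a *: P + Q) = (fun f => a *: eval_shift P f + eval_shift Q f).
Proof.
apply/funext => f.
exact: (msum_semilinear idfun (fun s : word d => shift_word s f)).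
Qed.

Lemma eval_backshift_comb a P Q :
  eval_backshift (a *: P + Q) =
  (fun f => a^* *: eval_backshift P f + eval_backshift Q f).
Proof.
apply/funext => f.
exact: (msum_semilinear Num.conj (fun s : word d => backshift_word s f)).
Qed.

Lemma eval_shiftU (s : word d) : eval_shift (Zpow R s) = shift_word s.
Proof.
by apply/funext => f; exact: (msumU idfun (fun s : word d => shift_word s f)).
Qed.

Lemma eval_backshiftU s : eval_backshift (Zpow R s) = backshift_word s.
Proof.
by apply/funext => f; exact: (msumU Num.conj (fun s : word d => backshift_word s f)).
Qed.

Lemma eval_shift0 : eval_shift (0 : ncpoly R d) = (fun=> 0).
Proof. by apply/funext => f; rewrite /eval_shift msupp0 big_seq_fset0. Qed.

Lemma eval_backshift0 : eval_backshift 0 = (fun=> 0).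
Proof. by apply/funext => f; rewrite /eval_backshift msupp0 big_seq_fset0. Qed.

(* Since [backshift i \o shift j] is [0] or the identity, every product
   [(L^t)^* L^s] is of this form, and these operators form a vector space inside
   the operator system, so that [mu] can be expanded over finite sums of them. *)
Definition toeplitz T : Prop :=
  exists P Q, T = (fun f => eval_shift P f + eval_backshift Q f).

Lemma linear_eval_shift P : linear (eval_shift P).
Proof.
exact: (@linear_sum (word d) (msupp P) (fun s => P@_s) (fun s => shift_word s)
  shift_word_linear).
Qed.

Lemma linear_eval_backshift P : linear (eval_backshift P).
Proof.
exact: (@linear_sum (word d) (msupp P) (fun s => (P@_s)^*) (fun s => backshift_word s)
  backshift_word_linear).
Qed.

Lemma eval_backshift_shiftE Q P : eval_backshift Q \o eval_shift P =
  fun f => \sum_(s <- msupp P) P@_s *: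
    \sum_(t <- msupp Q) (Q@_t)^* *: (backshift_word t \o shift_word s) f.
Proof.
apply/funext => f; rewrite /= /eval_shift.
elim: (enum_fset (msupp P)) => [|s r IH].
  (* Linearity with scalar [-1] at zero vectors gives the value [0] at [0]. *)
  rewrite !big_nil; have := linear_eval_backshift Q (-1) 0 0.
  by rewrite scaler0 addr0 scaleN1r addNr.
by rewrite !big_cons linear_eval_backshift IH.
Qed.

Lemma toeplitz_operator_system T : toeplitz T -> operator_system T.
Proof.
(* A bounded element of a set lies in its norm closure, being its own approximant at distance [0].
   This is applied to both closures in the definition of [operator_system]. *)
have selfclosure (D : set (operator R d)) S : bounded_operator S -> D S ->
    norm_closure D S.
  move=> Sb DS; split=> // e e0; exists S => //.
  apply: le_lt_trans (_ : 0 < e%:E)%E; last by rewrite lte_fin.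
  apply: ge_ereal_sup => _ [f _ <-].
  by rewrite lee_fin /= subrr /hnorm hinner0 sqrtr0.
have disc P : disc_algebra (eval_shift P).
  apply: selfclosure; last by exists P.
  apply: sq_boundedP (linear_eval_shift _) _.
  by apply: sq_bounded_sum => s; exact: sq_bounded_shift_word.
move=> [P [Q ->]]; apply: selfclosure.
  apply: sq_boundedP.
    move=> a f g; rewrite linear_eval_shift linear_eval_backshift scalerDr.
    by rewrite addrACA.
  have := sq_bounded_comb 1
    (sq_bounded_sum (msupp P) (fun s => P@_s) sq_bounded_shift_word)
    (sq_bounded_sum (msupp Q) (fun s => (Q@_s)^*) sq_bounded_backshift_word).
  by under eq_fun do rewrite scale1r.
exists (eval_shift P) => //; exists (eval_shift Q) => //.
by rewrite (adjointP (eval_shift_adjoint Q)).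
Qed.

Lemma toeplitz_comb a S T : toeplitz S -> toeplitz T ->
  toeplitz (fun f => a *: S f + T f).
Proof.
move=> [P [Q ->]] [P' [Q' ->]]; exists (a *: P + P'), (a^* *: Q + Q').
rewrite eval_shift_comb eval_backshift_comb conjCK.
by apply/funext => f; rewrite scalerDr addrACA.
Qed.

Lemma toeplitz0 : toeplitz (fun=> 0).
Proof.
exists 0, 0; rewrite eval_shift0 eval_backshift0.
by apply/funext => f; rewrite addr0.
Qed.

(** The first letters of [t] and [s] meet: equal letters cancel, distinct ones give [0]. When one
    word is exhausted, what is left is a single [L^u] or a single [(L^u)^*]. *)
Lemma toeplitz_word s t : toeplitz (backshift_word t \o shift_word s).
Proof.
case: s t => [s] [t]; elim: t s => [|j t IH] s.
  exists (Zpow R (FMonom s)), 0; rewrite eval_shiftU eval_backshift0.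
  by apply/funext => f; rewrite addr0.
case: s => [|k s].
  exists 0, (Zpow R (FMonom (j :: t))); rewrite eval_shift0 eval_backshiftU.
  by apply/funext => f; rewrite add0r.
have [jk|/negbTE jk] := eqVneq j k; [have := IH s|have := toeplitz0];
  congr toeplitz; apply/funext => f; rewrite /= /backshift_word /shift_word /=.
  by rewrite backshift_shift jk eqxx.
rewrite backshift_shift jk; elim: t {IH} => //= i t IH.
by rewrite (_ : backshift i 0 = 0) //; apply/hardy_eqP.
Qed.

Lemma toeplitz_sum I (r : seq I) (c : I -> R[i]) (F : I -> operator R d) :
  (forall i, toeplitz (F i)) -> toeplitz (fun f => \sum_(i <- r) c i *: F i f).
Proof.
move=> FT; elim: r => [|i r IH].
  by under eq_fun do rewrite big_nil; exact: toeplitz0.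
by under eq_fun do rewrite big_cons; exact: toeplitz_comb.
Qed.

End Operators.

(** * Sesquilinear forms with nonnegative diagonal *)

Section SemiInnerProduct.
Context {C : numClosedFieldType} {V : lmodType C}.
Variable B : V -> V -> C.
Hypothesis B_linear : forall w, linear_for *%R (fun v => B v w).
Hypothesis B_antilinear : forall v, linear_for (Num.conj \; *%R) (B v).
Hypothesis B_ge0 : forall v, 0 <= B v v.

Let BDl u v w : B (u + v) w = B u w + B v w.
Proof. by have := B_linear w 1 u v; rewrite scale1r mul1r. Qed.

Let BDr u v w : B w (u + v) = B w u + B w v.
Proof. by have := B_antilinear w 1 u v; rewrite scale1r /= rmorph1 mul1r. Qed.

Let B0l w : B 0 w = 0.
Proof. by apply: (addrI (B 0 w)); rewrite -BDl !addr0. Qed.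

Let B0r w : B w 0 = 0.
Proof. by apply: (addrI (B w 0)); rewrite -BDr !addr0. Qed.

Let BZl a v w : B (a *: v) w = a * B v w.
Proof. by have := B_linear w a v 0; rewrite B0l !addr0. Qed.

Let BZr a v w : B w (a *: v) = a^* * B w v.
Proof. by have := B_antilinear w a v 0; rewrite B0r !addr0. Qed.

(* Polarization: [B (v + w) (v + w)] and [B (v + 'i w) (v + 'i w)] are real. *)
Lemma semi_inner_herm v w : B w v = (B v w)^*.
Proof.
have cross_real a : a^* * B v w + a * B w v \is Num.real.
  have -> : a^* * B v w + a * B w v =
      B (v + a *: w) (v + a *: w) - B v v - a * a^* * B w w.
    by rewrite !(BDl, BDr, BZl, BZr); ring.
  have rBB u : B u u \is Num.real by rewrite ger0_real.
  apply: rpredB; first exact: rpredB.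
  by apply: rpredM; rewrite // ger0_real // mul_conjC_ge0.
(* With [b = B v w] and [c = B w v], the scalar [1] gives [b^* + c^* = b + c] and ['i] gives
   [b^* - c^* = c - b]; the sum is [2 b^* = 2 c]. *)
have := CrealP (cross_real 'i); have := CrealP (cross_real 1).
rewrite !rmorphD !rmorphM /= !conjCK conjCi rmorph1 !mul1r => e1 ei.
have {}ei : 'i * ((B v w)^* - (B w v)^*) = 'i * (B w v - B v w).
  by rewrite !mulrBr -!mulNr ei; ring.
move/(mulfI (neq0Ci _)): ei => e2.
apply/esym/(mulfI (_ : 2 != 0 :> C)); first by rewrite pnatr_eq0.
transitivity (((B v w)^* + (B w v)^*) + ((B v w)^* - (B w v)^*)); first by ring.
by rewrite e1 e2; ring.
Qed.

(* If [b := B v w] were nonzero, [B (x v + w) (x v + w)] would be negative for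
   [x := - c b^*] with [c > 0] large. *)
Lemma semi_inner_null v w : B v v = 0 -> B v w = 0.
Proof.
move=> vv0; apply/eqP/negPn/negP => b0.
set b := B v w in b0; pose q := B w w.
have bb : 0 < b * b^* by rewrite mul_conjC_gt0.
(* The factor [(q + 1) / |b|^2] makes the two cross terms add up to [-2 (q + 1)], so that the total
   is [-(q + 2) < 0]. *)
have := B_ge0 (- ((q + 1) / (b * b^*) * b^*) *: v + w).
rewrite !(BDl, BDr, BZl, BZr) vv0 !mulr0 add0r (semi_inner_herm v w) -/b -/q.
have q0 : 0 <= q by exact: B_ge0.
have qr : ((q + 1) / (b * b^*))^* = (q + 1) / (b * b^*).
  apply/CrealP; rewrite ger0_real // divr_ge0 // ?addr_ge0 // ltW //.
rewrite rmorphN rmorphM /= qr conjCK.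
have -> : - ((q + 1) / (b * b^*) * b^*) * b + (- ((q + 1) / (b * b^*) * b) * b^* + q)
  = - (q + 2) by field; rewrite conjC_eq0 b0.
by rewrite oppr_ge0 lt_geF // ltr_wpDl.
Qed.

End SemiInnerProduct.

(** * The form [mu(Q^* P)] on polynomials: moments, positivity, definiteness *)

Section MomentForm.
Context {R : realType} {d : nat} (mu : nc_measure R d).
Implicit Types (P Q : ncpoly R d) (s t : word d).

Local Notation "''[' P , Q ]" := (ncpoly_inner mu P Q).

Lemma nc_fun0 : mu (fun=> 0) = 0.
Proof.
have T0 : operator_system (fun=> 0 : hardy R d).
  exact: (toeplitz_operator_system toeplitz0).
have := nc_linear mu 1 T0 T0.
rewrite (_ : (1 \*: _ \+ _) = fun=> 0); last first.
  by apply/funext => f /=; rewrite scaler0 addr0.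
by rewrite mul1r => /eqP; rewrite -subr_eq0 opprD addNKr oppr_eq0 => /eqP.
Qed.

(** [nc_linear] requires every partial sum to lie in the operator system, which the stability of
    [toeplitz] under combinations provides. *)
Lemma nc_fun_sum I (r : seq I) (c : I -> R[i]) (F : I -> operator R d) :
  (forall i, toeplitz (F i)) ->
  mu (fun f => \sum_(i <- r) c i *: F i f) = \sum_(i <- r) c i * mu (F i).
Proof.
move=> FT; elim: r => [|i r IH].
  by under eq_fun do rewrite big_nil; rewrite big_nil nc_fun0.
under eq_fun do rewrite big_cons; rewrite big_cons -IH.
by apply: nc_linear; apply: toeplitz_operator_system => //; exact: toeplitz_sum.
Qed.

Lemma momentE s t : moment mu s t = mu (backshift_word t \o shift_word s).
Proof. by rewrite /moment (adjointP (shift_word_adjoint t)). Qed.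

Lemma ncpoly_innerE P Q :
  '[P, Q] = \sum_(s <- msupp P) P@_s * \sum_(t <- msupp Q) (Q@_t)^* * moment mu s t.
Proof.
rewrite /ncpoly_inner (adjointP (eval_shift_adjoint Q)).
rewrite eval_backshift_shiftE.
rewrite (nc_fun_sum (msupp P) (fun s => P@_s) (F := fun s f =>
    \sum_(t <- msupp Q) (Q@_t)^* *: (backshift_word t \o shift_word s) f)).
  apply: eq_bigr => s _; congr (_ * _); rewrite nc_fun_sum.
    by apply: eq_bigr => t _; rewrite momentE.
  by move=> t; exact: toeplitz_word.
by move=> s; apply: toeplitz_sum => t; exact: toeplitz_word.
Qed.

Lemma ncpoly_inner_linear Q : linear_for *%R (fun P => '[P, Q]).
Proof.
move=> a P P'; rewrite !ncpoly_innerE.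
exact: (msum_semilinear idfun (V := R[i]^o)
  (fun s => \sum_(t <- msupp Q) (Q@_t)^* * moment mu s t : R[i]^o)).
Qed.

Lemma ncpoly_inner_antilinear P : linear_for (Num.conj \; *%R) (fun Q => '[P, Q]).
Proof.
have innerE Q : '[P, Q] =
    \sum_(t <- msupp Q) (Q@_t)^* * \sum_(s <- msupp P) P@_s * moment mu s t.
  rewrite ncpoly_innerE; under eq_bigr do rewrite mulr_sumr.
  rewrite exchange_big; apply: eq_bigr => t _; rewrite mulr_sumr.
  by apply: eq_bigr => s _; rewrite mulrCA.
move=> a Q Q'; rewrite !innerE.
exact: (msum_semilinear Num.conj (V := R[i]^o)
  (fun t => \sum_(s <- msupp P) P@_s * moment mu s t : R[i]^o)).
Qed.

Lemma ncpoly_innerU s t : '[Zpow R s, Zpow R t] = moment mu s t.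
Proof. by rewrite /ncpoly_inner !eval_shiftU. Qed.

Lemma toeplitz_gram P :
  toeplitz (eval_backshift P \o eval_shift P).
Proof.
rewrite eval_backshift_shiftE.
by apply: toeplitz_sum => s; apply: toeplitz_sum => t; exact: toeplitz_word.
Qed.

Lemma ncpoly_inner_ge0 P : 0 <= '[P, P].
Proof.
rewrite /ncpoly_inner (adjointP (eval_shift_adjoint P)).
have OS := toeplitz_operator_system (toeplitz_gram P).
(* Boundedness is part of membership in [norm_closure]. Positivity of [P(L)^* P(L)] at [f] is that
   of the squared norm of [P(L) f]. *)
apply: nc_ge0 => //; split; first by case: OS.
move=> f; rewrite /= hinnerC -eval_shift_adjoint hinnerC conjCK.
exact: hinner_ge0.
Qed.

Lemma ncpoly_innerC P Q : '[Q, P] = '[P, Q]^*.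
Proof.
exact: (semi_inner_herm ncpoly_inner_linear ncpoly_inner_antilinear ncpoly_inner_ge0).
Qed.

Lemma ncpoly_inner_null P Q : '[P, P] = 0 -> '[P, Q] = 0.
Proof.
exact: (semi_inner_null ncpoly_inner_linear ncpoly_inner_antilinear ncpoly_inner_ge0).
Qed.

Lemma ncpoly_inner_suml (I : Type) (r : seq I) (c : I -> R[i]) (F : I -> ncpoly R d) Q :
  '[\sum_(i <- r) c i *: F i, Q] = \sum_(i <- r) c i * '[F i, Q].
Proof.
elim: r => [|i r IH]; last by rewrite !big_cons ncpoly_inner_linear IH.
rewrite !big_nil; have := ncpoly_inner_linear Q 1 0 0.
rewrite scaler0 addr0 mul1r => /eqP.
by rewrite -subr_eq0 opprD addNKr oppr_eq0 => /eqP.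
Qed.

Definition supported_in (l : seq (word d)) P := forall s, s \notin l -> P@_s = 0.

Lemma supported_expand l P : uniq l -> supported_in l P ->
  P = \sum_(s <- l) P@_s *: Zpow R s.
Proof.
move=> ul lP; apply/malgP => t; rewrite raddf_sum /=.
under eq_bigr do rewrite mcoeffZ mcoeffU.
have [tl|tl] := boolP (t \in l).
  rewrite (bigD1_seq t) //= eqxx mulr1 big1 ?addr0 // => s /negbTE ->.
  by rewrite mulr0.
rewrite lP // big_seq big1 // => s sl.
by case: eqVneq tl => [<-|_ _]; [rewrite sl | rewrite mulr0].
Qed.

(** A null [P] is orthogonal to every monomial by [ncpoly_inner_null], so its row of coefficients is
    in the left kernel of the invertible moment matrix. *)
Lemma ncpoly_inner_definite s0 P : nontrivial_nc mu -> uniq (initseg s0) ->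
  supported_in (initseg s0) P -> '[P, P] = 0 -> P = 0.
Proof.
move=> mu_nt ul lP PP0; set l := initseg s0 in ul lP.
pose v : 'rV[R[i]]_(size l) := \row_i P@_(tnth (in_tuple l) i).
have vM0 : v *m moment_mx mu s0 = 0.
  apply/rowP => j; rewrite !mxE.
  rewrite -[RHS](ncpoly_inner_null (Zpow R (tnth (in_tuple l) j)) PP0).
  rewrite (supported_expand ul lP) ncpoly_inner_suml [RHS]big_tnth.
  by apply: eq_bigr => i _; rewrite !mxE ncpoly_innerU.
have v0 : v = 0 by rewrite -(mulmxK (mu_nt s0) v) vM0 mul0mx.
rewrite (supported_expand ul lP) big_tnth big1 // => i _.
have := congr1 (fun w : 'rV_(size l) => w 0 i) v0.
by rewrite !mxE => ->; rewrite scale0r.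
Qed.

End MomentForm.

(** * Initial segments of the shortlex order *)

Section InitialSegments.
Context {d : nat}.
Implicit Types s t u : word d.

Lemma shortlex_refl : reflexive (@shortlex d).
Proof. by move=> s; rewrite /shortlex eqxx lexx orbT. Qed.

Lemma shortlex_trans : transitive (@shortlex d).
Proof.
move=> t s u /orP[st|/andP[/eqP st lest]] /orP[tu|/andP[/eqP tu letu]].
- by rewrite /shortlex (ltn_trans st tu).
- by rewrite /shortlex -tu st.
- by rewrite /shortlex st tu.
- by rewrite /shortlex st tu eqxx (le_trans lest letu) orbT.
Qed.

Lemma shortlex_anti : antisymmetric (@shortlex d).
Proof.
move=> s t /andP[/orP[st|/andP[/eqP st lest]] /orP[ts|/andP[/eqP ts lets]]].
- by have := ltn_trans st ts; rewrite ltnn.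
- by move: st; rewrite ts ltnn.
- by move: ts; rewrite st ltnn.
- case: s t st lest ts lets => [s] [t] _ /= lest _ lets; congr FMonom.
  by apply: (@le_anti _ (seqlexi 'I_d)); rewrite lest lets.
Qed.

Lemma shortlex_total : total (@shortlex d).
Proof.
move=> s t; rewrite /shortlex; case: (ltngtP (size s) (size t)) => //= _.
exact: le_total.
Qed.

Lemma size_words_of_length m t : (t \in words_of_length d m) = (size t == m).
Proof.
apply/mapP/eqP => [[u _ ->]|<-]; first by rewrite size_tuple.
by exists (in_tuple t); rewrite ?mem_enum //= fmK.
Qed.

Lemma initseg_uniq s : uniq (initseg s).
Proof.
rewrite /initseg sort_uniq filter_uniq //.
have : uniq (iota 0 (size s).+1) by exact: iota_uniq.
elim: (iota _ _) => //= m ms IH /andP[mms ums].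
rewrite cat_uniq IH // andbT; apply/andP; split.
  by rewrite map_inj_uniq ?enum_uniq // => u v [] /val_inj.
apply/hasPn => t /flattenP[_ /mapP[m' m'ms ->]].
rewrite !size_words_of_length => /eqP tm'.
by apply: contraNN mms => /eqP <-; rewrite tm'.
Qed.

Lemma initseg_sorted s : sorted (@shortlex d) (initseg s).
Proof. exact/sort_sorted/shortlex_total. Qed.

(** Both sides are sorted for a partial order, so comparing their elements is enough. The prefix has
    length [i.+1] because the order is reflexive. *)
Lemma initseg_take s0 i : (i < size (initseg s0))%N ->
  initseg (nth (FMonom [::]) (initseg s0) i) = take i.+1 (initseg s0).
Proof.
set l := initseg s0; set s := nth _ _ _ => il.
apply: (sorted_eq shortlex_trans shortlex_anti); first exact: initseg_sorted.
  exact/take_sorted/initseg_sorted.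
have sl : s \in l by exact: mem_nth.
apply: uniq_perm; rewrite ?take_uniq ?initseg_uniq // => t.
rewrite mem_initseg; apply/idP/idP => [ts|/(nthP (FMonom [::]))[j]].
  have tl : t \in l.
    by rewrite mem_initseg (shortlex_trans ts) // -mem_initseg.
  rewrite in_take // leqNgt; apply/negP => it.
  have st : shortlex s t.
    rewrite -[t](nth_index (FMonom [::]) tl).
    apply: (sorted_ltn_nth shortlex_trans) => //; first exact: initseg_sorted.
    by rewrite inE index_mem.
  have ts_eq : t = s by apply: shortlex_anti; rewrite ts st.
  by move: it; rewrite ts_eq index_uniq ?initseg_uniq // ltnn.
rewrite size_takel // ltnS => ji <-; rewrite nth_take //.
apply: (sorted_leq_nth shortlex_trans shortlex_refl _ (initseg_sorted s0)) => //.
by rewrite inE (leq_ltn_trans ji).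
Qed.

Lemma mem_nil_initseg s : FMonom [::] \in initseg s.
Proof. by rewrite mem_initseg /shortlex; case: s => [[|? ?]]. Qed.

End InitialSegments.

(** * Orthonormality and spanning for Gram-Schmidt *)

Section GramSchmidt.
Context {R : realType} {d : nat} (mu : nc_measure R d).
Implicit Types (P Q : ncpoly R d) (s t : word d) (l : seq (word d)).

Local Notation "''[' P , Q ]" := (ncpoly_inner mu P Q).

Definition gram_schmidt l : seq (ncpoly R d) := foldl (gram_schmidt_step mu) [::] l.

Lemma gram_schmidt_rcons l s :
  gram_schmidt (rcons l s) = gram_schmidt_step mu (gram_schmidt l) s.
Proof. by rewrite /gram_schmidt foldl_rcons. Qed.

Lemma size_gram_schmidt l : size (gram_schmidt l) = size l.
Proof.
elim/last_ind: l => // l s IH.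
by rewrite gram_schmidt_rcons !size_rcons IH.
Qed.

Lemma nth_gram_schmidt_cat l l' i : (i < size l)%N ->
  nth 0 (gram_schmidt (l ++ l')) i = nth 0 (gram_schmidt l) i.
Proof.
elim/last_ind: l' => [|l' s IH] il; first by rewrite cats0.
rewrite -rcons_cat gram_schmidt_rcons nth_rcons size_gram_schmidt size_cat.
by rewrite (leq_trans il) ?leq_addr // IH.
Qed.

(** Each [orthopoly s] is the last output of a run on [initseg s]. That list is a prefix of
    [initseg s0] and a run only appends, so all these runs are truncations of a single one. *)
Lemma orthopolyE s0 :
  [seq orthopoly mu s | s <- initseg s0] = gram_schmidt (initseg s0).
Proof.
apply: (@eq_from_nth _ 0); rewrite size_map ?size_gram_schmidt // => i il.
rewrite (nth_map (FMonom [::])) // /orthopoly initseg_take //.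
rewrite -/(gram_schmidt _) -nth_last size_gram_schmidt size_takel //=.
rewrite -[in RHS](cat_take_drop i.+1 (initseg s0)).
by rewrite nth_gram_schmidt_cat // size_takel.
Qed.

Lemma mcoeff_comb0 (r : seq (ncpoly R d)) (c : ncpoly R d -> R[i]) t :
  (forall phi, phi \in r -> phi@_t = 0) -> (\sum_(phi <- r) c phi *: phi)@_t = 0.
Proof.
move=> r0; rewrite raddf_sum big_seq big1 //= => phi phir.
by rewrite mcoeffZ r0 // mulr0.
Qed.

Variable s0 : word d.
Hypothesis mu_nt : nontrivial_nc mu.

Lemma gram_schmidt_supported l P :
  P \in gram_schmidt l -> supported_in l P.
Proof.
elim/last_ind: l P => [|l s IH] P; first by [].
have IH' Q t : Q \in gram_schmidt l -> t \notin rcons l s -> Q@_t = 0.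
  by move=> /IH lQ; rewrite mem_rcons inE negb_or => /andP[_ /lQ].
rewrite gram_schmidt_rcons /gram_schmidt_step mem_rcons inE.
case/predU1P => [-> t tl|Pl t]; last exact: IH'.
rewrite mcoeffZ mcoeffB mcoeffU mcoeff_comb0 => [|Q Ql]; last exact: IH'.
case: eqVneq tl => [<-|_ _]; first by rewrite mem_rcons mem_head.
by rewrite subrr mulr0.
Qed.

(** The point is that no normalisation divides by [0]: earlier polynomials do not involve the new
    monomial, so [psi] has coefficient [1] there and is nonzero. The segment [s0] stays fixed during
    the induction since definiteness is known on initial segments. *)
Lemma gram_schmidt_spec l : uniq l -> {subset l <= initseg s0} ->
  (forall i j, (i < size l)%N -> (j < size l)%N ->
    '[(gram_schmidt l)`_i, (gram_schmidt l)`_j] = (i == j)%:R) /\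
  (forall s, s \in l -> Zpow R s =
    \sum_(phi <- gram_schmidt l) '[Zpow R s, phi] *: phi).
Proof.
elim/last_ind: l => [|l s IH] //; rewrite rcons_uniq => /andP[sl ul] lsub.
have sub_l : {subset l <= initseg s0}.
  by move=> t tl; apply: lsub; rewrite mem_rcons inE tl orbT.
have [ortho expand] := IH ul sub_l; set g := gram_schmidt l in ortho expand.
have size_g : size g = size l by exact: size_gram_schmidt.
pose psi := Zpow R s - \sum_(phi <- g) '[Zpow R s, phi] *: phi.
pose c := sqrtC '[psi, psi].
have gs : gram_schmidt (rcons l s) = rcons g (c^-1 *: psi).
  by rewrite gram_schmidt_rcons.
have psi_s : psi@_s = 1.
  rewrite mcoeffB mcoeffU eqxx mcoeff_comb0 ?subr0 // => phi phig.
  by rewrite (gram_schmidt_supported phig).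
have psi_supp : supported_in (initseg s0) psi.
  move=> t ts0; rewrite mcoeffB mcoeffU mcoeff_comb0 => [|phi phig].
    case: eqVneq ts0 => [<-|_ _]; first by rewrite lsub // mem_rcons mem_head.
    by rewrite subrr.
  rewrite (gram_schmidt_supported phig) //.
  by apply: contra ts0; exact: sub_l.
have psi_gt0 : 0 < '[psi, psi].
  rewrite lt_def ncpoly_inner_ge0 andbT; apply/eqP => psi0.
  have := ncpoly_inner_definite mu_nt (initseg_uniq s0) psi_supp psi0.
  by move=> /(congr1 (mcoeff s)); rewrite psi_s mcoeff0 => /eqP; rewrite oner_eq0.
have c0 : c != 0 by rewrite sqrtC_eq0 gt_eqF.
have cc : c * c^* = '[psi, psi].
  have /CrealP -> : c \is Num.real by rewrite ger0_real // sqrtC_ge0 ltW.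
  by rewrite -expr2 sqrtCK.
have innerBl P P' Q : '[P - P', Q] = '[P, Q] - '[P', Q].
  by rewrite addrC -scaleN1r ncpoly_inner_linear mulN1r addrC.
have psi_ortho i : (i < size l)%N -> '[psi, g`_i] = 0.
  move=> il; rewrite innerBl ncpoly_inner_suml (big_nth 0) size_g big_mkord.
  rewrite (bigD1 (Ordinal il) isT) /= (ortho i i il il) eqxx mulr1.
  rewrite big1 => [|j ji]; first by rewrite addr0 subrr.
  rewrite ortho //; case: eqP => [jiE|_]; rewrite ?mulr0 //.
  by case/eqP: ji; apply: val_inj.
have innerZl a P Q : '[a *: P, Q] = a * '[P, Q].
  by have := ncpoly_inner_suml mu [:: tt] (fun=> a) (fun=> P) Q; rewrite !big_seq1.
have innerZr a P Q : '[P, a *: Q] = a^* * '[P, Q].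
  by rewrite ncpoly_innerC innerZl rmorphM /= -ncpoly_innerC.
have new_ortho i : (i < size l)%N -> '[c^-1 *: psi, g`_i] = 0.
  by move=> il; rewrite innerZl psi_ortho // mulr0.
rewrite gs; split.
  move=> i j; rewrite size_rcons !ltnS !nth_rcons size_g => il jl.
  have [il'|il'] := ltnP i (size l); have [jl'|jl'] := ltnP j (size l).
  - exact: ortho.
  - have -> : j = size l by apply/eqP; rewrite eqn_leq jl jl'.
    by rewrite eqxx ncpoly_innerC new_ortho // rmorph0 ltn_eqF.
  - have -> : i = size l by apply/eqP; rewrite eqn_leq il il'.
    by rewrite eqxx new_ortho // eq_sym ltn_eqF.
  - have -> : i = size l by apply/eqP; rewrite eqn_leq il il'.
    have -> : j = size l by apply/eqP; rewrite eqn_leq jl jl'.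
    rewrite !eqxx innerZl innerZr -cc fmorphV /= (mulrCA (_^-1) c).
    by rewrite mulVf ?conjC_eq0 // mulr1 mulVf.
move=> t; rewrite mem_rcons inE big_rcons /=.
case/predU1P => [->|tl].
  (* [Z^s] is [psi] plus a combination of earlier polynomials, which are orthogonal to [psi]; and
     [<psi, psi> = c c^*]. *)
  have -> : '[Zpow R s, c^-1 *: psi] = c.
    have {1}-> : Zpow R s = psi + \sum_(phi <- g) '[Zpow R s, phi] *: phi.
      by rewrite subrK.
    rewrite -[X in X + _]scale1r ncpoly_inner_linear mul1r ncpoly_inner_suml.
    rewrite innerZr -cc fmorphV /= mulrCA mulVf ?conjC_eq0 // mulr1.
    rewrite (big_nth 0) big_mkord big1 ?addr0 // => j _.
    by rewrite (ncpoly_innerC mu (c^-1 *: psi)) new_ortho ?rmorph0 ?mulr0 // -size_g.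
  by rewrite scalerA mulfV // scale1r addrC subrK.
have -> : '[Zpow R t, c^-1 *: psi] = 0.
  rewrite (expand t tl) ncpoly_inner_suml (big_nth 0) big_mkord big1 // => j _.
  by rewrite (ncpoly_innerC mu (c^-1 *: psi)) new_ortho ?rmorph0 ?mulr0 // -size_g.
by rewrite scale0r addr0 -expand.
Qed.

End GramSchmidt.

(** * Matrix least squares in the Loewner order *)

Section LeastSquares.
Context {R : realType} {k : nat} {I : eqType}.
Implicit Types (M N : 'M[R[i]]_k) (r : seq I) (Phi X : I -> 'M[R[i]]_k).

Lemma trmxC_mul m n p (A : 'M[R[i]]_(m, n)) (B : 'M[R[i]]_(n, p)) :
  (A *m B) ^t* = B ^t* *m A ^t*.
Proof. by rewrite trmx_mul map_mxM. Qed.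

Lemma trmxCK m n (A : 'M[R[i]]_(m, n)) : (A ^t*) ^t* = A.
Proof. by apply/matrixP => i j; rewrite !mxE conjCK. Qed.

Lemma trmxC_sum r X : (\sum_(i <- r) X i) ^t* = \sum_(i <- r) (X i) ^t*.
Proof. by rewrite !raddf_sum. Qed.

Lemma trmxC_sub M N : (M - N) ^t* = M ^t* - N ^t*.
Proof. by rewrite !raddfB. Qed.

Lemma hermsymmxP M : M ^t* = M -> M \is hermsymmx.
Proof. by move=> MM; rewrite is_hermitianmxE expr0 scale1r MM. Qed.

Lemma gram_sum_herm r X : (\sum_(i <- r) (X i) ^t* *m X i) ^t* =
  \sum_(i <- r) (X i) ^t* *m X i.
Proof. by rewrite trmxC_sum; apply: eq_bigr => i _; rewrite trmxC_mul trmxCK. Qed.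

Lemma gram_cV_ge0 m (v : 'cV[R[i]]_m) : 0 <= (v ^t* *m v) 0 0.
Proof. by rewrite mxE sumr_ge0 // => i _; rewrite !mxE mulrC mul_conjC_ge0. Qed.

Lemma gram_cV_eq0 m (v : 'cV[R[i]]_m) : (v ^t* *m v) 0 0 = 0 -> v = 0.
Proof.
rewrite mxE => v0; apply/colP => i; rewrite mxE; apply/eqP.
rewrite -mul_conjC_eq0 mulrC; have := v0.
under eq_bigr do rewrite !mxE.
move/psumr_eq0P => -> // j _; by rewrite mulrC mul_conjC_ge0.
Qed.

Lemma psdmx_gram_sum r X : psdmx (\sum_(i <- r) (X i) ^t* *m X i).
Proof.
split=> [|v]; first exact/hermsymmxP/gram_sum_herm.
rewrite mulmx_sumr mulmx_suml summxE sumr_ge0 // => i _.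
by rewrite mulmxA -trmxC_mul -mulmxA gram_cV_ge0.
Qed.

Variables (r : seq I) (Phi : I -> 'M[R[i]]_k).

Let S : 'M[R[i]]_k := \sum_(i <- r) Phi i *m (Phi i) ^t*.

(** If [v S = 0] for a row [v], then [v S v^*] is a vanishing sum of the squared norms of the rows
    [v Phi_i]. Hence each [v Phi_i] is [0], and so is [v], the sum of the [v Phi_i X_i]. *)
Lemma right_inverse_unitmx X : \sum_(i <- r) Phi i *m X i = 1%:M -> S \in unitmx.
Proof.
move=> PhiX; rewrite -row_free_unit -kermx_eq0; apply/rowV0P => v /sub_kermxP vS.
have vPhi i : i \in r -> v *m Phi i = 0.
  have : \sum_(i <- r) (((v *m Phi i) ^t*) ^t* *m (v *m Phi i) ^t*) 0 0 = 0.
    rewrite -summxE; transitivity ((v *m S *m v ^t*) 0 0); last first.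
      by rewrite vS mul0mx mxE.
    congr (fun_of_matrix _ 0 0); rewrite /S mulmx_sumr mulmx_suml.
    by apply: eq_bigr => j _; rewrite trmxCK trmxC_mul !mulmxA.
  move/eqP; rewrite psumr_eq0 => [/allP h ir|j _]; last exact: gram_cV_ge0.
  have /eqP/gram_cV_eq0 e := h i ir.
  by rewrite -[LHS]trmxCK e trmx0 map_mx0.
rewrite -[v]mulmx1 -PhiX mulmx_sumr big_seq big1 // => i ir.
by rewrite mulmxA vPhi // mul0mx.
Qed.

Hypothesis S_unit : S \in unitmx.

Let S_herm : S ^t* = S.
Proof. by rewrite trmxC_sum; apply: eq_bigr => i _; rewrite trmxC_mul trmxCK. Qed.

Let invS_herm : (invmx S) ^t* = invmx S.
Proof. by rewrite trmx_inv map_invmx S_herm. Qed.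

Definition least_squares_solution i := (Phi i) ^t* *m invmx S.

Lemma least_squares_feasible :
  \sum_(i <- r) Phi i *m least_squares_solution i = 1%:M.
Proof.
under eq_bigr do rewrite mulmxA.
by rewrite -mulmx_suml mulmxV.
Qed.

(** The cross term is the same for all feasible [X]: the solution is orthogonal to all differences
    of feasible points. *)
Lemma least_squares_cross X : \sum_(i <- r) Phi i *m X i = 1%:M ->
  \sum_(i <- r) (least_squares_solution i) ^t* *m X i = invmx S.
Proof.
move=> PhiX; rewrite -[RHS]mulmx1 -PhiX mulmx_sumr; apply: eq_bigr => i _.
by rewrite trmxC_mul trmxCK invS_herm mulmxA.
Qed.

Lemma least_squares_value : \sum_(i <- r)
  (least_squares_solution i) ^t* *m least_squares_solution i = invmx S.
Proof. exact/least_squares_cross/least_squares_feasible. Qed.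

(* With [Y] the least-squares solution,
   [\sum X^* X - S^-1 = \sum (X - Y)^* (X - Y)]. *)
Lemma least_squares_le X : \sum_(i <- r) Phi i *m X i = 1%:M ->
  loewner_le (invmx S) (\sum_(i <- r) (X i) ^t* *m X i).
Proof.
move=> PhiX; rewrite /loewner_le.
have := psdmx_gram_sum r (fun i => X i - least_squares_solution i).
congr psdmx; under eq_bigr do
  rewrite trmxC_sub mulmxBl !mulmxBr opprB addrC.
rewrite big_split /= !sumrB least_squares_value (least_squares_cross PhiX).
rewrite subrr add0r; congr (_ - _).
rewrite -[RHS]invS_herm -(least_squares_cross PhiX) trmxC_sum.
by apply: eq_bigr => i _; rewrite trmxC_mul trmxCK.
Qed.

End LeastSquares.

(** * Fourier expansion of matrix polynomials *)

Section Christoffel.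
Context {R : realType} {d : nat} (mu : nc_measure R d).
Variables (k : nat) (A : 'I_d -> 'M[R[i]]_k).
Implicit Types (P : ncpoly R d) (Q : 'M[ncpoly R d]_k) (s t : word d).

Local Notation "''[' P , Q ]" := (ncpoly_inner mu P Q).

Lemma msupp_mxsupp Q i j : (msupp (Q i j) `<=` mxsupp Q)%fset.
Proof.
have entry : (msupp (Q i j) `<=` \big[fsetU/fset0]_(j < k) msupp (Q i j))%fset.
  by apply: bigfcup_sup; rewrite ?mem_index_enum.
apply: fsubset_trans entry _.
apply: (@bigfcup_sup _ _ _ i xpredT
  (fun i => \big[fsetU/fset0]_(j < k) msupp (Q i j))%fset) => //.
by rewrite mem_index_enum.
Qed.

(** [mx_gram] sums over the common support of all entries of a matrix, so inner products of entries
    must be written over that set too. *)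
Lemma ncpoly_inner_incl (E : {fset word d}) P P' :
  (msupp P `<=` E)%fset -> (msupp P' `<=` E)%fset ->
  '[P, P'] = \sum_(s <- E) \sum_(t <- E) P@_s * (P'@_t)^* * moment mu s t.
Proof.
move=> PE P'E; rewrite ncpoly_innerE.
rewrite (msum_incl idfun (V := R[i]^o)
  (fun s => \sum_(t <- msupp P') (P'@_t)^* * moment mu s t : R[i]^o) PE).
apply: eq_bigr => s _ /=.
rewrite (msum_incl Num.conj (V := R[i]^o) (fun t => moment mu s t : R[i]^o) P'E).
by rewrite scaler_sumr; apply: eq_bigr => t _; rewrite scalerA.
Qed.

Lemma mx_gramE Q i j : mx_gram mu Q i j = \sum_(m < k) '[Q m j, Q m i].
Proof.
under eq_bigr do rewrite (ncpoly_inner_incl (msupp_mxsupp _ _ _) (msupp_mxsupp _ _ _)).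
rewrite exchange_big [RHS]/=; under [RHS]eq_bigr do rewrite exchange_big.
rewrite exchange_big /= /mx_gram summxE; apply: eq_bigr => s _.
rewrite summxE; apply: eq_bigr => t _; rewrite !mxE mulr_sumr.
by apply: eq_bigr => m _; rewrite !mxE mulrC (mulrC (_^*)).
Qed.

Lemma mx_evalE Q i j : mx_eval A Q i j = \sum_(m < k) eval_mx A (Q m j) i m.
Proof.
rewrite /mx_eval summxE; under eq_bigr do rewrite mxE.
rewrite exchange_big; apply: eq_bigr => m _ /=.
rewrite /eval_mx (msum_incl idfun (fun s => mx_word A s) (msupp_mxsupp Q m j)) summxE.
by apply: eq_bigr => s _; rewrite !mxE mulrC.
Qed.

Lemma eval_mx_sum (r : seq (ncpoly R d)) (c : ncpoly R d -> R[i]) :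
  eval_mx A (\sum_(phi <- r) c phi *: phi) = \sum_(phi <- r) c phi *: eval_mx A phi.
Proof.
elim: r => [|phi r IH]; last first.
  by rewrite !big_cons -IH; exact: (msum_semilinear idfun (fun s => mx_word A s)).
by rewrite !big_nil /eval_mx msupp0 big_seq_fset0.
Qed.

Variable s0 : word d.
Hypothesis mu_nt : nontrivial_nc mu.

Let g := gram_schmidt mu (initseg s0).

Definition fourier_mx Q (phi : ncpoly R d) : 'M[R[i]]_k := \matrix_(i, j) '[Q i j, phi].

Lemma ncpoly_upto_expand P : ncpoly_upto s0 P ->
  P = \sum_(phi <- g) '[P, phi] *: phi.
Proof.
have [_ expand] := gram_schmidt_spec mu_nt (initseg_uniq s0) (fun s h => h).
move=> [c ->]; under [RHS]eq_bigr do rewrite ncpoly_inner_suml scaler_suml.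
rewrite exchange_big big_seq [RHS]big_seq; apply: eq_bigr => s sl /=.
rewrite [in LHS](expand s sl) scaler_sumr.
by apply: eq_bigr => phi _; rewrite scalerA.
Qed.

Lemma mx_gram_fourier Q : (forall i j, ncpoly_upto s0 (Q i j)) ->
  mx_gram mu Q = \sum_(phi <- g) (fourier_mx Q phi) ^t* *m fourier_mx Q phi.
Proof.
move=> Qs0; apply/matrixP => i j; rewrite mx_gramE summxE.
under [RHS]eq_bigr do rewrite mxE.
rewrite exchange_big; apply: eq_bigr => m _ /=.
rewrite {1}(ncpoly_upto_expand (Qs0 m j)) ncpoly_inner_suml.
by apply: eq_bigr => phi _; rewrite !mxE -ncpoly_innerC mulrC.
Qed.

Lemma mx_eval_fourier Q : (forall i j, ncpoly_upto s0 (Q i j)) ->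
  mx_eval A Q = \sum_(phi <- g) eval_mx A phi *m fourier_mx Q phi.
Proof.
move=> Qs0; apply/matrixP => i j; rewrite mx_evalE summxE.
under [RHS]eq_bigr do rewrite mxE.
rewrite exchange_big; apply: eq_bigr => m _ /=.
rewrite {1}(ncpoly_upto_expand (Qs0 m j)) eval_mx_sum summxE.
by apply: eq_bigr => phi _; rewrite !mxE mulrC.
Qed.

Lemma ncpoly_upto_supported P : supported_in (initseg s0) P -> ncpoly_upto s0 P.
Proof.
by exists (fun s => P@_s); apply: supported_expand => //; exact: initseg_uniq.
Qed.

(** Gives attainment of the minimum: the least-squares solution has to be the Fourier data of an
    actual matrix polynomial. *)
Lemma gram_schmidt_synthesis (X : ncpoly R d -> 'M[R[i]]_k) :
  exists2 Q : 'M[ncpoly R d]_k, forall i j, ncpoly_upto s0 (Q i j) &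
    forall phi, phi \in g -> fourier_mx Q phi = X phi.
Proof.
exists (\matrix_(i, j) \sum_(phi <- g) X phi i j *: phi) => [i j|phi].
  apply: ncpoly_upto_supported => s sl; rewrite mxE.
  by apply: mcoeff_comb0 => phi /gram_schmidt_supported ->.
have [ortho _] := gram_schmidt_spec mu_nt (initseg_uniq s0) (fun s h => h).
move=> /(nthP 0)[m]; rewrite size_gram_schmidt => ml <-.
apply/matrixP => i j; rewrite !mxE ncpoly_inner_suml (big_nth 0).
rewrite size_gram_schmidt big_mkord (bigD1 (Ordinal ml)) //= ortho // eqxx mulr1.
rewrite big1 ?addr0 // => m' m'm; rewrite ortho //.
by case: eqP => [mE|_]; rewrite ?mulr0 //; case/eqP: m'm; apply: val_inj.
Qed.

Lemma sum_eval_orthopoly_unitmx :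
  \sum_(phi <- g) eval_mx A phi *m (eval_mx A phi) ^t* \in unitmx.
Proof.
(* The constant polynomial [1 (x) I_k], admissible because the empty word lies in every initial
   segment; its Fourier matrices are the [X] of [right_inverse_unitmx]. *)
pose Q : 'M[ncpoly R d]_k := \matrix_(i, j) ((i == j)%:R *: Zpow R (FMonom [::])).
have Qs0 i j : ncpoly_upto s0 (Q i j).
  apply: ncpoly_upto_supported => s sl; rewrite mxE mcoeffZ mcoeffU.
  by case: (eqVneq (FMonom [::]) s) sl => [<-|_ _]; rewrite ?mem_nil_initseg // mulr0.
apply: (right_inverse_unitmx (X := fourier_mx Q)).
rewrite -mx_eval_fourier //; apply/matrixP => i j; rewrite mx_evalE !mxE.
have evalQ m : eval_mx A (Q m j) i m = (m == j)%:R * (i == m)%:R.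
  have := eval_mx_sum [:: Zpow R (FMonom [::])] (fun=> (m == j)%:R).
  rewrite !big_seq1 mxE => ->; rewrite mxE; congr (_ * _).
  rewrite /eval_mx (msumU idfun (fun s => mx_word A s)).
  by rewrite /mx_word big_nil mxE.
under eq_bigr do rewrite evalQ.
rewrite (bigD1 i) //= eqxx mulr1 big1 ?addr0 // => m mi.
by rewrite [i == m]eq_sym (negbTE mi) mulr0.
Qed.

End Christoffel.

Local Open Scope complex_scope.

Theorem lemma5p5 (R : realType) (d : nat) (hd : (0 < d)%N)
    (mu : nc_measure R d) (mu_prob : probability_nc mu)
    (mu_nontrivial : nontrivial_nc mu)
    (n k : nat) (hk : (0 < k)%N) (A : 'I_d -> 'M[R[i]]_k) :
  loewner_min
    [set mx_gram mu Q | Q in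
       [set Q : 'M[ncpoly R d]_k |
          (forall i j, ncpoly_upto (last_word hd n) (Q i j)) /\
          mx_eval A Q = 1%:M]]
    (christoffel hd mu n A).
Proof.
have S_unit := sum_eval_orthopoly_unitmx A (last_word hd n) mu_nontrivial.
(* Reindexes the sum over words by the output of one Gram-Schmidt run, the index list of the Fourier
   expansions. *)
rewrite /christoffel -(big_map (orthopoly mu) xpredT
  (fun phi => eval_mx A phi *m (eval_mx A phi) ^t*)) orthopolyE.
split=> [_ [Q [Qs0 _] <-]||_ [Q [Qs0 QA] <-]].
- by rewrite (mx_gram_fourier mu_nontrivial Qs0); have [] := psdmx_gram_sum
    (gram_schmidt mu (initseg (last_word hd n))) (fourier_mx mu Q).
- set g := gram_schmidt mu _ in S_unit *.
  have [Q Qs0 QX] := gram_schmidt_synthesis (last_word hd n) mu_nontrivial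
    (least_squares_solution g (eval_mx A)).
  exists Q; first split=> //.
    rewrite (mx_eval_fourier A mu_nontrivial Qs0) -(least_squares_feasible S_unit).
    by rewrite big_seq [RHS]big_seq; apply: eq_bigr => phi /QX ->.
  rewrite (mx_gram_fourier mu_nontrivial Qs0) -(least_squares_value S_unit).
  by rewrite big_seq [RHS]big_seq; apply: eq_bigr => phi /QX ->.
- rewrite (mx_gram_fourier mu_nontrivial Qs0); apply: least_squares_le => //.
  by rewrite -(mx_eval_fourier A mu_nontrivial Qs0).
Qed.
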